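(* Let $I=\{1,\ldots,l\}$, let $f_i\colon\mathcal{H}\to\mathbb{R}$, $i\in I\cup\{0\}$, be DC functions, and consider the problem $$\min_{x \in \mathcal{H}} f_0(x) \quad \text{subject to} \quad f_i(x) \le 0, \quad i \in I, \qquad (\mathcal{P}_I)$$ with feasible region $\Omega$. Suppose that there exists a globally optimal solution of $(\mathcal{P}_I)$ at which the interior point constraint qualification (IPCQ) holds true, and let $x_*$ be a feasible point of $(\mathcal{P}_I)$. Let also $f_0$ be bounded below on $\Omega$, and let $D f_i=[\underline{d} f_i,\overline{d} f_i]$ be a global codifferential of $f_i$, $i \in I \cup \{ 0 \}$. Suppose, finally, that $C_i \subseteq \overline{d} f_i(x_* )$ is a nonempty set such that $\overline{d} f_i(x_* ) = \operatorname{cl}\operatorname{co} C_i$, $i \in I \cup \{ 0 \}$. Then $x_*$ is a globally optimal solution of $(\mathcal{P}_I)$ if and only if for any $z_i \in C_i$, $i \in I \cup \{ 0 \}$, one has $a(z) \ge 0$, where $(a(z), v(z))$ with $z = (z_0, z_1, \ldots, z_l)$ is the globally optimal solution of the problem $$\min_{(a, v) \in \mathbb{R} \times \mathcal{H}} \| (a, v) \|^2 \quad \text{subject to} \quad (a, v) \in L(z)$$ and $$L(z) = \operatorname{cl}\operatorname{co}\{ \underline{d} f_0(x_* ) + z_0, \: \underline{d} f_i(x_* ) + z_i + (f_i(x_* ), 0) \mid i \in I \}.$$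
   Context: $\mathcal{H}$ is a real Hilbert space with inner product $\langle\cdot,\cdot\rangle$; $\mathbb{R}\times\mathcal{H}$ carries the norm $\|(a,v)\| = \sqrt{a^2+\|v\|^2}$. $\operatorname{cl}$ and $\operatorname{co}$ denote closure and convex hull; $\operatorname{co}$ of a family of sets means the convex hull of their union. ''Closed'' convex function means lower semicontinuous. An affine support set of a proper closed convex function $g\colon\mathcal{H}\to\mathbb{R}\cup\{\pm\infty\}$ is any closed convex set $S_g\subset\mathbb{R}\times\mathcal{H}$ such that $g(x)=\sup_{(a,v)\in S_g}(a+\langle v,x\rangle)$ for all $x\in\mathcal{H}$. A DC function is a finite-valued $f\colon\mathcal{H}\to\mathbb{R}$ of the form $f=g-h$ with $g,h\colon\mathcal{H}\to\mathbb{R}$ closed convex functions. Given such a decomposition and any affine support sets $S_g$, $S_h$ of $g$, $h$, set for $x\in\mathcal{H}$ $$\underline{d} f(x) = \{ (a - g(x) + \langle v, x \rangle, v) \mid (a, v) \in S_g \},\quad \overline{d} f(x) = \{ (- b + h(x) - \langle w, x \rangle, - w) \mid (b, w) \in S_h \}.$$ The pair $Df=[\underline{d} f,\overline{d} f]$ is called a global codifferential of $f$ associated with the DC decomposition $f=g-h$; a global codifferential of $f$ is any pair obtained in this way. IPCQ holds at a point $x_0\in\Omega$ if $x_0 \in \operatorname{cl} \{ x \in \mathcal{H} \mid f_i(x) < 0 \ \forall i \in I \}$. *)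

(* Defs.v *)
From HB Require Import structures.
From mathcomp Require Import all_boot all_order all_algebra sesquilinear.
From mathcomp Require Import all_classical all_reals all_analysis.
Import Order.TTheory GRing.Theory Num.Theory.
Import numFieldNormedType.Exports.

Set Implicit Arguments.
Unset Strict Implicit.
Unset Printing Implicit Defensive.

Local Open Scope classical_set_scope.
Local Open Scope ring_scope.

(* A real Hilbert space is a [completeNormedModType] with a symmetric positive
   definite bilinear form [{dot H for idfun}] that induces its norm. *)
Definition induces_norm (R : realType) (H : completeNormedModType R)
    (dot : {dot H for idfun}) : Prop :=
  forall x : H, `|x| ^+ 2 = dot x x.

(* The library norm on a product is the max norm; it is equivalent to
   [eucl_norm], so [closed] and [closure] below refer to the topology of
   [eucl_norm] as well. *)
Definition eucl_norm (R : realType) (H : normedModType R) (p : R^o * H) : R :=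
  Num.sqrt (p.1 ^+ 2 + `|p.2| ^+ 2).

Definition conv_hull (R : realType) (E : lmodType R) (A : set E) : set E :=
  smallest (fun B : set E => convex_set B) A.

Definition closed_convex_function (R : realType) (H : normedModType R)
    (g : H -> R) : Prop :=
  convex_function [set: convex_lmodType H] g /\
  lower_semicontinuous (EFin \o g).

Definition DC_function (R : realType) (H : normedModType R)
    (f : H -> R) : Prop :=
  exists g h : H -> R, [/\ closed_convex_function g, closed_convex_function h &
    forall x, f x = g x - h x].

Definition affine_support_set (R : realType) (H : completeNormedModType R)
    (dot : {dot H for idfun}) (g : H -> \bar R) (S : set (R^o * H)) : Prop :=
  [/\ closed S, convex_set S &
    forall x, g x = ereal_sup [set (s.1 + dot s.2 x)%:E | s in S]].

Definition hypodiff (R : realType) (H : completeNormedModType R)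
    (dot : {dot H for idfun}) (g : H -> R) (Sg : set (R^o * H)) (x : H) :
    set (R^o * H) :=
  [set (s.1 - g x + dot s.2 x, s.2) | s in Sg].

Definition hyperdiff (R : realType) (H : completeNormedModType R)
    (dot : {dot H for idfun}) (h : H -> R) (Sh : set (R^o * H)) (x : H) :
    set (R^o * H) :=
  [set (- s.1 + h x - dot s.2 x, - s.2) | s in Sh].

Definition global_codifferential (R : realType) (H : completeNormedModType R)
    (dot : {dot H for idfun}) (f : H -> R) (dl du : H -> set (R^o * H)) : Prop :=
  exists (g h : H -> R) (Sg Sh : set (R^o * H)),
    [/\ closed_convex_function g, closed_convex_function h &
        forall x, f x = g x - h x] /\
    [/\ affine_support_set dot (EFin \o g) Sg,
        affine_support_set dot (EFin \o h) Sh,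
        dl = hypodiff dot g Sg & du = hyperdiff dot h Sh].

Definition global_minimizer (R : realType) (T : Type) (F : T -> R) (A : set T)
    (x : T) : Prop :=
  A x /\ forall y, A y -> F x <= F y.

(* In a family [f : 'I_l.+1 -> H -> R], [f ord0] is the objective and the
   [f i] with [i != ord0] are the [l] constraints. *)
Definition feasible (R : realType) (H : Type) (l : nat)
    (f : 'I_l.+1 -> H -> R) : set H :=
  [set x | forall i, i != ord0 -> f i x <= 0].

Definition IPCQ (R : realType) (H : topologicalType) (l : nat)
    (f : 'I_l.+1 -> H -> R) (x0 : H) : Prop :=
  closure [set x | forall i, i != ord0 -> f i x < 0] x0.

Definition Lset (R : realType) (H : completeNormedModType R) (l : nat)
    (f : 'I_l.+1 -> H -> R) (dl : 'I_l.+1 -> H -> set (R^o * H)) (x : H)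
    (z : 'I_l.+1 -> R^o * H) : set (R^o * H) :=
  closure (conv_hull
    ([set p + z ord0 | p in dl ord0 x] `|`
     \bigcup_(i in [set i | i != ord0])
       [set p + z i + (f i x, 0) | p in dl i x])).

(* Main.v *)
(* Put k_0 = 0, k_i = f_i(x_star) for i <> 0, and
   F(y) = max_i (f_i(y) - f_i(x_star) + k_i).  The codifferentials give
   F(y) <= sup_{(a, v) in L(z)} (a + <v, y - x_star>) for all z_i in C_i,
   and a y with F(y) < 0 makes the right-hand side negative for some such z.
   Let (a, v) be the element of least norm of L(z) and
   d = ||(a, v)||, so that a a' + <v, v'> >= d^2 on L(z).
   If a < 0, then y = x_star + v / a has F(y) < 0, so x_star is not optimal.
   If x_star is not optimal, IPCQ and the upper semicontinuity of f_0 (a finite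
   lower semicontinuous convex function on a Banach space is continuous, by
   Baire) yield u and z with a' + <v', u> <= c < 0 on L(z); if a >= 0, then
   <v', v - a u> >= d^2 - a c > 0 on L(z), hence F tends to -oo along
   x_star + u - t (v - a u), contradicting that f_0 is bounded below. *)

Require Import Defs.
From HB Require Import structures.
From mathcomp Require Import all_boot all_order all_algebra sesquilinear.
From mathcomp Require Import all_classical all_reals all_analysis.
From mathcomp Require Import ring lra.
Import Order.TTheory GRing.Theory Num.Theory.
Import numFieldNormedType.Exports.

Set Implicit Arguments.
Unset Strict Implicit.
Unset Printing Implicit Defensive.

Local Open Scope classical_set_scope.
Local Open Scope ring_scope.

(** * The inner product of R x H and its half-spaces *)

Section inner_product.
Variables (R : realType) (H : completeNormedModType R).
Variables (dot : {dot H for idfun}).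

Lemma dotC (x y : H) : dot x y = dot y x.
Proof. by rewrite hermC expr0 mul1r. Qed.

Lemma dotDl (x y z : H) : dot (x + y) z = dot x z + dot y z.
Proof. exact: linearDl. Qed.

Lemma dotZl (k : R) (x y : H) : dot (k *: x) y = k * dot x y.
Proof. exact: linearZl_LR. Qed.

Lemma dotNl (x y : H) : dot (- x) y = - dot x y.
Proof. exact: linearNl. Qed.

Lemma dotBr (x y z : H) : dot x (y - z) = dot x y - dot x z.
Proof. exact: linearBr. Qed.

(** The inner product behind [eucl_norm]; pairing with [(1, u)] evaluates the affine function a +
    <v, .> at u. *)
Definition dot2 (p q : R^o * H) : R := p.1 * q.1 + dot p.2 q.2.

Lemma dot2C p q : dot2 p q = dot2 q p.
Proof. by rewrite /dot2 mulrC dotC. Qed.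

Lemma dot2Dl p q r : dot2 (p + q) r = dot2 p r + dot2 q r.
Proof. by rewrite /dot2 /= dotDl mulrDl addrACA. Qed.

Lemma dot2Zl (k : R) p q : dot2 (k *: p) q = k * dot2 p q.
Proof. by rewrite /dot2 /= dotZl mulrDr mulrA. Qed.

Lemma dot2Nl p q : dot2 (- p) q = - dot2 p q.
Proof. by rewrite -scaleN1r dot2Zl mulN1r. Qed.

Lemma dot2Bl p q r : dot2 (p - q) r = dot2 p r - dot2 q r.
Proof. by rewrite dot2Dl dot2Nl. Qed.

Lemma dot2Zr (k : R) p q : dot2 p (k *: q) = k * dot2 p q.
Proof. by rewrite dot2C dot2Zl dot2C. Qed.

Lemma dot2Dr p q r : dot2 p (q + r) = dot2 p q + dot2 p r.
Proof. by rewrite dot2C dot2Dl !(dot2C p). Qed.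

Lemma dot2Nr p q : dot2 p (- q) = - dot2 p q.
Proof. by rewrite dot2C dot2Nl dot2C. Qed.

Lemma dot2Br p q r : dot2 p (q - r) = dot2 p q - dot2 p r.
Proof. by rewrite dot2C dot2Bl !(dot2C p). Qed.

Hypothesis dot_norm : induces_norm dot.

Lemma dot2_ge0 p : 0 <= dot2 p p.
Proof. by rewrite /dot2 -dot_norm addr_ge0 ?sqr_ge0 // -expr2 sqr_ge0. Qed.

Lemma eucl_norm_dot2 p : eucl_norm p ^+ 2 = dot2 p p.
Proof.
rewrite /eucl_norm sqr_sqrtr ?addr_ge0 ?sqr_ge0 //.
by rewrite /dot2 -expr2 -dot_norm.
Qed.

Lemma dot2_eq0 p : dot2 p p = 0 -> p = 0.
Proof.
case: p => a v; rewrite /dot2 /= -dot_norm => /eqP.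
rewrite paddr_eq0 ?sqr_ge0 -?expr2 ?sqr_ge0 // !expf_eq0 /= normr_eq0.
by move=> /andP[/eqP -> /eqP ->].
Qed.

Lemma dot2_continuous q : continuous (dot2 q).
Proof.
(* Polarization reduces continuity to that of the norm. *)
have dotE u x : dot u x = 2^-1 * (`|u + x| ^+ 2 - `|u| ^+ 2 - `|x| ^+ 2).
  rewrite !dot_norm dotDl (dotC u) (dotC x (u + x)) !dotDl (dotC x u).
  by field.
move=> p; rewrite /dot2; apply: cvgD.
  by apply: cvgMr; exact: cvg_fst.
rewrite dotE; under eq_fun do rewrite dotE.
have cs : (fun x : R^o * H => x.2) @ p --> p.2 by exact: cvg_snd.
apply: cvgMr; apply: cvgB; last first.
  by rewrite expr2; under eq_fun do rewrite expr2; apply: cvgM; exact: cvg_norm.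
apply: cvgB; last exact: cvg_cst.
rewrite expr2; under eq_fun do rewrite expr2.
by apply: cvgM; apply: cvg_norm; apply: cvgD => //; exact: cvg_cst.
Qed.

Lemma halfspace_closed q k : closed [set p | k <= dot2 q p].
Proof.
apply: (@closed_comp _ _ (dot2 q) [set x | k <= x]); last exact: closed_ge.
by move=> x _; exact: dot2_continuous.
Qed.

Lemma halfspace_convex q k : convex_set [set p | k <= dot2 q p].
Proof.
move=> x y t; rewrite !inE /= => kx ky.
rewrite dot2Dr !dot2Zr.
have t0 : 0 <= t%:inum by [].
have t1 : t%:inum <= 1 by [].
rewrite -[leRHS]/(t%:inum * dot2 q x + (1 - t%:inum) * dot2 q y); nra.
Qed.

(** A half-space is closed and convex, so it contains the closed convex hull of any set it
    contains. *)
Lemma closed_hull_halfspace (A : set (R^o * H)) q k :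
  (forall p, A p -> k <= dot2 q p) ->
  forall p, closure (conv_hull A) p -> k <= dot2 q p.
Proof.
move=> Ak p; rewrite closureE => /(_ [set p | k <= dot2 q p]); apply.
split; first exact: halfspace_closed.
move=> r /(_ [set p | k <= dot2 q p]); apply; split => //.
exact: halfspace_convex.
Qed.

End inner_product.

(** * Convex hulls and closures *)

Section convexity.
Variables (R : realType) (E : normedModType R).

Lemma convex_closure (A : set E) : convex_set A -> convex_set (closure A).
Proof.
move=> cA x y t; rewrite !inE => Ax Ay B.
have : {for (x, y), continuous (fun q : E * E =>
   t%:inum *: q.1 + (1 - t%:inum) *: q.2)}.
  by apply: cvgD; apply: cvgZr; [exact: cvg_fst|exact: cvg_snd].
move=> /[apply] -[[U V] /= [/Ax[a [Aa Ua]] /Ay[b [Ab Vb]]]] UV.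
exists (t%:inum *: a + (1 - t%:inum) *: b); split; last exact: (UV (a, b)).
by have := cA a b t; rewrite !inE; apply.
Qed.

Lemma convex_hull_convex (A : set E) : convex_set (conv_hull A).
Proof.
move=> x y t; rewrite !inE => Ax Ay B /= [cB AB].
have := cB x y t; rewrite !inE; apply; [exact: Ax|exact: Ay].
Qed.

Lemma sub_conv_hull (A : set E) : A `<=` conv_hull A.
Proof. exact: sub_smallest. Qed.

End convexity.

(** * The element of least norm of a closed convex set *)

Lemma sqr_cauchy_cvg (R : realType) (V : completeNormedModType R)
    (u : V ^nat) (e : R ^nat) :
  e @ \oo --> 0 -> (forall m n, `|u m - u n| ^+ 2 <= e m + e n) -> cvgn u.
Proof.
move=> e0 ue; apply/cauchy_cvgP/cauchy_exP => d d0.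
have d2 : 0 < d ^+ 2 / 2 by rewrite divr_gt0 ?exprn_gt0.
have small : \forall n \near \oo, e n < d ^+ 2 / 2.
  by move: (d ^+ 2 / 2) d2; apply: cvgr_lt e0.
have [N eN] := filter_ex small.
exists (u N); apply: filterS small => n en.
rewrite -ball_normE /= -(@ltr_pXn2r _ 2) ?nnegrE ?(ltW d0) //.
by apply: le_lt_trans (ue N n) _; lra.
Qed.

Section min_norm.
Variables (R : realType) (H : completeNormedModType R).
Variables (dot : {dot H for idfun}).
Hypothesis dot_norm : induces_norm dot.
Variable L : set (R^o * H).
Hypothesis L_convex : convex_set L.

Lemma min_norm_dot2_le (p q : R^o * H) :
  global_minimizer (fun r => eucl_norm r ^+ 2) L p -> L q ->
  dot2 dot p p <= dot2 dot p q.
Proof.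
move=> [Lp pmin] Lq; rewrite leNgt; apply/negP => lt_qp.
set D := dot2 dot p p - dot2 dot p q.
have D0 : 0 < D by rewrite subr_gt0.
set N := dot2 dot (q - p) (q - p).
have N0 : 0 <= N by exact: dot2_ge0.
have DN0 : 0 < D + N by rewrite ltr_wpDr.
(* Moving from p towards q by t changes the squared norm by -2tD + t^2 N. For t = D / (D + N) one
   has tN <= D < 2D, so the norm would drop below the minimum. *)
have t0 : 0 <= D / (D + N) by rewrite divr_ge0 // ltW.
have t1 : D / (D + N) <= 1 by rewrite ler_pdivrMr // mul1r lerDl.
have := @L_convex q p (Itv01 t0 t1); rewrite !inE => /(_ Lq Lp).
rewrite -[conv _ _ _]/(D / (D + N) *: q + (1 - D / (D + N)) *: p).
move: t0 t1; set t := D / (D + N) => t0 t1 /pmin.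
have -> : t *: q + (1 - t) *: p = p + t *: (q - p).
  by rewrite scalerBr scalerBl scale1r addrCA.
rewrite !(eucl_norm_dot2 dot_norm) !dot2Dl !dot2Dr !dot2Zl !dot2Zr -/N.
rewrite (dot2C dot (q - p) p) dot2Br.
have tE : t * (D + N) = D by rewrite /t divfK // gt_eqF.
have tpos : 0 < t by rewrite divr_gt0.
rewrite -(opprB (dot2 dot p p)) -/D; nra.
Qed.

Lemma min_norm_exists : closed L -> L !=set0 ->
  exists p, global_minimizer (fun r => eucl_norm r ^+ 2) L p.
Proof.
move=> L_closed [p0 Lp0].
pose E := [set dot2 dot p p | p in L].
have E_lb : has_lbound E by exists 0 => _ [p _ <-]; exact: dot2_ge0.
have E_inf : has_inf E by split=> //; exists (dot2 dot p0 p0), p0.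
have infE p : L p -> inf E <= dot2 dot p p.
  by move=> Lp; apply: ge_inf => //; exists p.
have [u Lu] : exists u : nat -> R^o * H, forall n, L (u n) /\
    dot2 dot (u n) (u n) < inf E + n.+1%:R^-1.
  suff /choice[u uP] : forall n : nat, exists p,
      L p /\ dot2 dot p p < inf E + n.+1%:R^-1 by exists u.
  move=> n.
  have [|_ [p Lp <-] ltp] := @inf_adherent _ E n.+1%:R^-1 _ E_inf.
    by rewrite invr_gt0.
  by exists p.
(* Parallelogram law: the midpoint of [u m] and [u n] lies in [L], so its squared norm is at least
   [inf E]. *)
have u_cauchy m n : dot2 dot (u m - u n) (u m - u n) <=
    2 * m.+1%:R^-1 + 2 * n.+1%:R^-1.
  have h0 : (0 : R) <= 2^-1 by rewrite invr_ge0.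
  have h1 : (2^-1 : R) <= 1 by rewrite invf_le1 ?ler1n.
  have := @L_convex (u m) (u n) (Itv01 h0 h1).
  rewrite !inE => /(_ (Lu m).1 (Lu n).1) /infE.
  rewrite -[conv _ _ _]/(2^-1 *: u m + (1 - 2^-1) *: u n).
  have [_ um] := Lu m; have [_ un] := Lu n.
  rewrite !(dot2Dl, dot2Nl, dot2Dr, dot2Nr, dot2Zl, dot2Zr).
  rewrite (dot2C dot (u n) (u m)).
  move: um un; move: m.+1%:R^-1 n.+1%:R^-1 (inf E) => em en d um un; lra.
have e0 : (fun n => 2 * n.+1%:R^-1 : R) @ \oo --> 0.
  by rewrite -(mulr0 2); apply: cvgMr; exact: cvg_harmonic.
have dot2E p : dot2 dot p p = `|p.1| * `|p.1| + `|p.2| * `|p.2|.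
  by rewrite -(eucl_norm_dot2 dot_norm) /eucl_norm sqr_sqrtr
    ?addr_ge0 ?sqr_ge0 // -!expr2 real_normK ?num_real.
have cu1 : cvgn (fun n => (u n).1).
  apply: (sqr_cauchy_cvg e0) => m n; apply: le_trans (u_cauchy m n).
  by rewrite dot2E lerDl -expr2 sqr_ge0.
have cu2 : cvgn (fun n => (u n).2).
  apply: (sqr_cauchy_cvg e0) => m n; apply: le_trans (u_cauchy m n).
  by rewrite dot2E lerDr -expr2 sqr_ge0.
pose l := (limn (fun n => (u n).1), limn (fun n => (u n).2)) : R^o * H.
have ul : u @ \oo --> l.
  have -> : u = (fun n => ((u n).1, (u n).2)) by apply/funext => n; case: (u n).
  exact: (@cvg_pair _ _ _ _ (nbhs l.1) (nbhs l.2) _ _ _ _ _ cu1 cu2).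
have Ll : L l.
  by apply: closed_cvg L_closed _ _ ul; near=> n; exact: (Lu n).1.
exists l; split=> // q Lq; rewrite !(eucl_norm_dot2 dot_norm).
apply: le_trans (infE _ Lq).
have qu : (fun n => dot2 dot (u n) (u n)) @ \oo --> dot2 dot l l.
  rewrite dot2E; under eq_fun do rewrite dot2E.
  by apply: cvgD; apply: cvgM; apply: cvg_norm.
have eu : (fun n => inf E + n.+1%:R^-1) @ \oo --> inf E.
  rewrite -[X in _ --> X]addr0.
  by apply: cvgD; [exact: cvg_cst|exact: cvg_harmonic].
by apply: (ler_cvg_to qu eu); near=> n; exact/ltW/(Lu n).2.
Unshelve. all: by end_near. Qed.

(** The variational inequalities at p and at q add up to ||p - q||^2 <= 0. *)
Lemma min_norm_unique (p q : R^o * H) :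
  global_minimizer (fun r => eucl_norm r ^+ 2) L p ->
  global_minimizer (fun r => eucl_norm r ^+ 2) L q -> p = q.
Proof.
move=> pmin qmin; apply/eqP; rewrite -subr_eq0; apply/eqP.
apply: (dot2_eq0 dot_norm); apply/eqP; rewrite eq_le dot2_ge0 // andbT.
have := min_norm_dot2_le pmin qmin.1; have := min_norm_dot2_le qmin pmin.1.
rewrite !(dot2Bl, dot2Br) (dot2C dot q p); lra.
Qed.

End min_norm.

(** Baire bounds g above on some ball; convexity carries the bound to a ball around x, then turns it
    into upper semicontinuity at x. *)
Lemma closed_convex_function_usc (R : realType) (H : completeNormedModType R)
    (g : H -> R) (x : H) (c : R) :
  closed_convex_function g -> g x < c -> \forall y \near x, g y < c.
Proof.
move=> [g_convex /lower_semicontinuousP g_lsc] gxc.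
have convE (t : R) y z : 0 <= t -> t <= 1 ->
    g (t *: y + (1 - t) *: z) <= t * g y + (1 - t) * g z.
  by move=> t0 t1; exact: (g_convex (Itv01 t0 t1) y z (in_setT _) (in_setT _)).
(* The sets {g > n} are open; were they all dense, some point would have g above every natural
   number. *)
have [n] : exists n : nat, ~ dense [set y | (n%:R%:E < (g y)%:E)%E].
  apply/not_existsP => all_dense.
  have : dense (\bigcap_(n : nat) [set y | (n%:R%:E < (g y)%:E)%E]).
    apply: Baire => n; split; first exact: g_lsc.
    by apply: contrapT => /all_dense.
  move=> /(_ setT); case; [by exists 0|exact: openT|].
  move=> y [_ /(_ (Num.truncn (g y)).+1 Logic.I)] /=.
  by rewrite lte_fin ltNge ltW // truncnS_gt.
move=> /denseNE[U [[b /open_nbhs_nbhs /nbhs_ballP[r /= r0 brU]] U0]].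
have gb y : `|y - b| < r -> g y <= n%:R.
  move=> yb; rewrite leNgt; apply/negP => ny.
  have Uy : U y by apply: brU; rewrite -ball_normE /= distrC.
  by have : (U `&` [set y | (n%:R%:E < (g y)%:E)%E]) y; [|rewrite U0].
(* Any y within r / 2 of x is the midpoint of the reflection 2x - b and of a point within r of b. *)
set M := 2^-1 * g (2 *: x - b) + 2^-1 * n%:R.
have gM y : `|y - x| < r / 2 -> g y <= M.
  move=> yx.
  have -> : y = 2^-1 *: (2 *: x - b) + (1 - 2^-1) *: (2 *: (y - x) + b).
    have -> : 1 - 2^-1 = 2^-1 :> R by lra.
    rewrite -scalerDr addrACA addNr addr0 -scalerDr subrKC scalerA.
    by rewrite mulVf ?scale1r.
  apply: le_trans (convE _ _ _ _ _) _; [lra|lra|].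
  rewrite /M lerD2l.
  have -> : 1 - 2^-1 = 2^-1 :> R by lra.
  apply: ler_wpM2l; first lra.
  apply: gb; rewrite addrK normrZ normr_nat; lra.
set e := c - g x; have e0 : 0 < e by rewrite subr_gt0.
(* This t makes t |M - g x| < e. Points near x are then written as combinations of x, with weight 1
   - t, and a point where g <= M. *)
pose t := e / (e + `|M - g x|).
have d0 : 0 < e + `|M - g x| by rewrite ltr_wpDr.
have t0 : 0 < t by rewrite divr_gt0.
have t1 : t <= 1 by rewrite ler_pdivrMr // mul1r lerDl.
have tM : t * `|M - g x| < e.
  rewrite /t mulrAC -mulrA gtr_pMr // ltr_pdivrMr // mul1r ltrDr //.
apply/nbhs_ballP; exists (t * (r / 2)) => /=.
  by rewrite mulr_gt0 // divr_gt0.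
move=> y; rewrite -ball_normE /= distrC => yx.
have -> : y = t *: (x + t^-1 *: (y - x)) + (1 - t) *: x.
  by rewrite scalerDr scalerA divff ?gt_eqF // scale1r scalerBl scale1r addrC
    addrA subrK subrKC.
apply: le_lt_trans (convE _ _ _ (ltW t0) t1) _.
have /gM : `|x + t^-1 *: (y - x) - x| < r / 2.
  by rewrite addrC addKr normrZ gtr0_norm ?invr_gt0 // ltr_pdivrMl.
move=> /(ler_wpM2l (ltW t0)); have := ler_wpM2l (ltW t0) (ler_norm (M - g x)).
rewrite /e in tM; lra.
Qed.

(** * Estimates of f from its codifferential *)

Section codifferential.
Variables (R : realType) (H : completeNormedModType R).
Variables (dot : {dot H for idfun}).
Hypothesis dot_norm : induces_norm dot.
Variable (f : H -> R).
Variables (dl du : H -> set (R^o * H)).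
Hypothesis f_codiff : global_codifferential dot f dl du.

Lemma hypodiff_neq0 x : dl x !=set0.
Proof.
have [g [h [Sg [Sh [_ [[_ _ gE] _ -> _]]]]]] := f_codiff.
have [Sg0|/set0P[s Ss]] := eqVneq Sg set0.
  (* The supremum over the empty set is -oo, whereas g is finite. *)
  by have := gE x; rewrite Sg0 image_set0 ereal_sup0.
by exists (s.1 - g x + dot s.2 x, s.2), s.
Qed.

(** The element z encodes an affine minorant of h, so its value at y - x is at least h x - h y; the
    supremum over [dl x] is g y - g x. *)
Lemma codiff_le x y e z : du x z ->
  (forall p, dl x p -> dot2 dot (1, y - x) (p + z) <= e) -> f y - f x <= e.
Proof.
have [g [h [Sg [Sh [[_ _ fE] [[_ _ gE] [_ _ hE] -> ->]]]]]] := f_codiff.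
move=> [s Ss <-] dle.
have : ((s.1 + dot s.2 y)%:E <= (h y)%:E)%E.
  by rewrite [leRHS]hE; apply: ereal_sup_ubound; exists s.
rewrite lee_fin => hy.
have : ((g y)%:E <= (e + g x - h x + h y)%:E)%E.
  rewrite [leLHS]gE; apply: ge_ereal_sup => _ [q Sq <-]; rewrite lee_fin.
  have := dle _ (ex_intro2 _ _ q Sq erefl).
  rewrite /dot2 /= !mul1r (dotC dot (y - x)) dotDl dotNl !dotBr; lra.
by rewrite lee_fin !fE; lra.
Qed.

(** The infimum over [du x] of the values at y - x is h x - h y, and passing to the generators [C]
    does not change it; hence some z in [C] comes close enough. *)
Lemma codiff_lt (C : set (R^o * H)) x y e :
  du x = closure (conv_hull C) -> f y - f x < e ->
  exists z, C z /\ exists2 e', e' < e &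
    forall p, dl x p -> dot2 dot (1, y - x) (p + z) <= e'.
Proof.
have [g [h [Sg [Sh [[_ _ fE] [[_ _ gE] [_ _ hE] -> ->]]]]]] := f_codiff.
move=> duE; rewrite !fE => fe.
have [z Cz zlt] : exists2 z, C z & dot2 dot (1, y - x) z < e - (g y - g x).
  apply: contrapT => /forall2NP Clt.
  have Cge p : C p -> e - (g y - g x) <= dot2 dot (1, y - x) p.
    by move=> Cp; rewrite leNgt; apply/negP; case: (Clt p).
  have : ((h y)%:E <= (h x - e + g y - g x)%:E)%E.
    rewrite [leLHS]hE; apply: ge_ereal_sup => _ [q Sq <-]; rewrite lee_fin.
    have : hyperdiff dot h Sh x (- q.1 + h x - dot q.2 x, - q.2) by exists q.
    rewrite duE => /(closed_hull_halfspace dot_norm Cge).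
    rewrite /dot2 /= !mul1r (dotC dot (y - x)) dotNl dotBr; lra.
  by rewrite lee_fin; lra.
exists z; split=> //; exists (g y - g x + dot2 dot (1, y - x) z); first lra.
move=> _ [q Sq <-]; rewrite dot2Dr lerD2r.
have : ((q.1 + dot q.2 y)%:E <= (g y)%:E)%E.
  by rewrite [leRHS]gE; apply: ereal_sup_ubound; exists q.
rewrite lee_fin /dot2 /= mul1r (dotC dot (y - x)) dotBr; lra.
Qed.

Lemma codiff_usc x c : f x < c -> \forall y \near x, f y < c.
Proof.
have [g [h [Sg [Sh [[gc [_ h_lsc] fE] _]]]]] := f_codiff.
rewrite fE => gc'.
(* Half of the slack c - f x is left for the growth of g, half for the decrease of h. *)
have gx : g x < g x + (c - (g x - h x)) / 2 by lra.
have hx : ((h x - (c - (g x - h x)) / 2)%:E < (h x)%:E)%E.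
  by rewrite lte_fin; lra.
have [V Vx Vh] := h_lsc _ _ hx.
near=> y; rewrite fE.
have : g y < g x + (c - (g x - h x)) / 2.
  by near: y; exact: closed_convex_function_usc.
have : ((h x - (c - (g x - h x)) / 2)%:E < (h y)%:E)%E by apply: Vh; near: y.
rewrite lte_fin; lra.
Unshelve. all: by end_near. Qed.

End codifferential.

(** * Least-norm elements of L(z) and the values of the f_i *)

Section Lset.
Variables (R : realType) (H : completeNormedModType R).
Variables (dot : {dot H for idfun}).
Hypothesis dot_norm : induces_norm dot.
Variables (l : nat) (f : 'I_l.+1 -> H -> R).
Variables (dl du : 'I_l.+1 -> H -> set (R^o * H)).
Hypothesis f_codiff : forall i, global_codifferential dot (f i) (dl i) (du i).

(** These shifts k_i give the generators of [Lset] one form for objective and constraints. *)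
Definition constraint_value (x : H) (i : 'I_l.+1) : R :=
  if i == ord0 then 0 else f i x.

Variables (x : H) (z : 'I_l.+1 -> R^o * H).
Let cval := constraint_value x.

Lemma dl_sub_Lset i p : dl i x p -> Lset f dl x z (p + z i + (cval i, 0)).
Proof.
move=> dp; apply: subset_closure; apply: sub_conv_hull.
rewrite /cval /constraint_value; case: eqVneq => [i0|i0].
  by left; exists p; rewrite -?i0 // addr0.
by right; exists i => //; exists p.
Qed.

Lemma Lset_neq0 : Lset f dl x z !=set0.
Proof.
have [p dp] := hypodiff_neq0 (f_codiff ord0) x.
by exists (p + z ord0 + (cval ord0, 0)); exact: dl_sub_Lset.
Qed.

Lemma Lset_convex : convex_set (Lset f dl x z).
Proof. exact/convex_closure/convex_hull_convex. Qed.

Lemma Lset_closed : closed (Lset f dl x z).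
Proof. exact: closed_closure. Qed.

Lemma dot2_cval u p i :
  dot2 dot (1, u) (p + (cval i, 0)) = dot2 dot (1, u) p + cval i.
Proof. by rewrite dot2Dr {2}/dot2 /= mul1r linear0r addr0. Qed.

Lemma Lset_le u e :
  (forall i p, dl i x p -> dot2 dot (1, u) (p + z i) <= e - cval i) ->
  forall p, Lset f dl x z p -> dot2 dot (1, u) p <= e.
Proof.
move=> dle p Lp; rewrite -lerN2 -dot2Nl.
move: p Lp; apply: (closed_hull_halfspace dot_norm).
move=> _ [[p dp <-]|[i i0 [p dp <-]]].
  rewrite dot2Nl lerN2; have := dle _ _ dp.
  by rewrite /cval /constraint_value eqxx subr0.
rewrite dot2Nl lerN2; have := dle _ _ dp.
have := dot2_cval u (p + z i) i.
rewrite /cval /constraint_value (negbTE i0) => ->.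
by rewrite lerBrDr.
Qed.

Lemma le_of_Lset_le y e : (forall i, du i x (z i)) ->
  (forall p, Lset f dl x z p -> dot2 dot (1, y - x) p <= e) ->
  forall i, f i y - f i x <= e - cval i.
Proof.
move=> duz Le i; apply: (codiff_le (f_codiff i) (duz i)) => p dp.
by rewrite lerBrDr -dot2_cval; apply: Le; exact: dl_sub_Lset.
Qed.

Lemma Lset_min_norm :
  exists! p, global_minimizer (fun q => eucl_norm q ^+ 2) (Lset f dl x z) p.
Proof.
have [p pmin] := min_norm_exists dot_norm Lset_convex Lset_closed Lset_neq0.
by exists p; split=> // q; exact: (min_norm_unique dot_norm Lset_convex).
Qed.

Lemma Lset_min_norm_descent a v : (forall i, du i x (z i)) ->
  global_minimizer (fun q => eucl_norm q ^+ 2) (Lset f dl x z) (a, v) ->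
  a < 0 -> exists y, forall i, f i y - f i x < - cval i.
Proof.
(* Here (1, y - x) is (a, v) / a; dividing the variational inequality by a < 0 reverses it into the
   upper bound D / a < 0. *)
move=> duz avmin a0; exists (x + a^-1 *: v) => i.
set D := dot2 dot (a, v) (a, v).
have D0 : 0 < D.
  have : 0 <= dot2 dot (0, v) (0, v) by exact: dot2_ge0.
  by rewrite /D /dot2 /= mul0r add0r; nra.
have Le p : Lset f dl x z p ->
    dot2 dot (1, x + a^-1 *: v - x) p <= a^-1 * D.
  move=> /(min_norm_dot2_le dot_norm Lset_convex avmin).
  have -> : (1, x + a^-1 *: v - x) = a^-1 *: (a, v) :> R^o * H.
    congr pair; last by rewrite addrC addKr.
    by rewrite -[RHS]/(a^-1 * a) mulVf // lt_eqF.
  by rewrite dot2Zl ler_nM2l // invr_lt0.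
apply: le_lt_trans (le_of_Lset_le duz Le i) _.
by rewrite gtrDr nmulr_rlt0 // invr_lt0.
Qed.

Lemma Lset_min_norm_unbounded a v u c : (forall i, du i x (z i)) ->
  global_minimizer (fun q => eucl_norm q ^+ 2) (Lset f dl x z) (a, v) ->
  0 <= a -> c < 0 -> (forall p, Lset f dl x z p -> dot2 dot (1, u) p <= c) ->
  forall b, exists y, forall i, f i y - f i x <= Num.min b c - cval i.
Proof.
move=> duz avmin a0 c0 Lu b.
set D := dot2 dot (a, v) (a, v).
have D0 : 0 < D.
  (* If (a, v) were 0, then 0 would lie in L(z), where [(1, u)] takes values at most c < 0. *)
  rewrite lt_neqAle eq_sym dot2_ge0 // andbT.
  apply/eqP => /(dot2_eq0 dot_norm) av0.
  have := Lu _ avmin.1; rewrite av0.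
  by rewrite -(scale0r (0 : R^o * H)) dot2Zr mul0r leNgt c0.
(* The first component of w vanishes, so [(1, u) - t *: w] still has first component 1 and
   corresponds to a point of H. *)
set w := (a, v) - a *: (1, u) : R^o * H.
have wE : w = (0, v - a *: u).
  by congr pair; rewrite -[LHS]/(a - a * 1) mulr1 subrr.
have Lw p : Lset f dl x z p -> D <= dot2 dot w p.
  move=> Lp; have := min_norm_dot2_le dot_norm Lset_convex avmin Lp.
  by have := Lu p Lp; rewrite /w dot2Bl dot2Zl -/D; nra.
(* With this t the values on L(z) are at most c - |b|, which is below both b and c. *)
pose t := `|b| / D.
have t0 : 0 <= t by rewrite divr_ge0 // ltW.
exists (x + (u - t *: (v - a *: u))).
apply: le_of_Lset_le duz _ => p Lp.
have -> : (1, x + (u - t *: (v - a *: u)) - x) = (1, u) - t *: w :> R^o * H.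
  rewrite wE; congr pair; last by rewrite addrC addKr.
  by rewrite -[RHS]/(1 - t * 0) mulr0 subr0.
rewrite dot2Bl dot2Zl.
have tD : t * D = `|b| by rewrite divfK // gt_eqF.
have := ler_wpM2l t0 (Lw p Lp); rewrite tD => tw.
have := Lu p Lp; have := normr_ge0 b; have := ler_norm (- b); rewrite normrN.
by rewrite le_min => *; apply/andP; split; lra.
Qed.

End Lset.

(** * The optimality criterion *)

Theorem theorem2 (R : realType) (H : completeNormedModType R)
    (dot : {dot H for idfun}) (dot_norm : induces_norm dot)
    (l : nat) (f : 'I_l.+1 -> H -> R)
    (f_DC : forall i, DC_function (f i))
    (opt_IPCQ : exists x0 : H,
      global_minimizer (f ord0) (feasible f) x0 /\ IPCQ f x0)
    (xs : H) (xs_feas : feasible f xs)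
    (f0_bounded : has_lbound (f ord0 @` feasible f))
    (dl du : 'I_l.+1 -> H -> set (R^o * H))
    (f_codiff : forall i, global_codifferential dot (f i) (dl i) (du i))
    (C : 'I_l.+1 -> set (R^o * H))
    (C_sub : forall i, C i `<=` du i xs)
    (C_neq0 : forall i, C i !=set0)
    (C_gen : forall i, du i xs = closure (conv_hull (C i))) :
  (forall z : 'I_l.+1 -> R^o * H, (forall i, C i (z i)) ->
     exists! p : R^o * H,
       global_minimizer (fun q => eucl_norm q ^+ 2) (Lset f dl xs z) p) /\
  (global_minimizer (f ord0) (feasible f) xs <->
   forall z : 'I_l.+1 -> R^o * H, (forall i, C i (z i)) ->
   forall (a : R) (v : H),
     global_minimizer (fun q => eucl_norm q ^+ 2) (Lset f dl xs z) (a, v) ->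
     0 <= a).
Proof.
(* This conjunct makes a(z) well defined. *)
split=> [z _|]; first exact: (Lset_min_norm dot_norm f_codiff).
have descent y e :
    (forall i, f i y - f i xs <= e - constraint_value f xs i) ->
    f ord0 y - f ord0 xs <= e /\ forall i, i != ord0 -> f i y <= e.
  move=> ylt; split=> [|i i0].
    by have := ylt ord0; rewrite /constraint_value eqxx subr0.
  by have := ylt i; rewrite /constraint_value (negbTE i0) lerBlDr subrK.
split=> [[_ xs_min] z Cz a v avmin|a_ge0].
  rewrite leNgt; apply/negP => a0.
  have duz i : du i xs (z i) by exact: C_sub.
  have [y ylt] := Lset_min_norm_descent dot_norm f_codiff duz avmin a0.
  have y_feas : feasible f y.
    move=> i i0; have := ylt i.
    by rewrite /constraint_value (negbTE i0) ltrBlDr addNr => /ltW.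
  have := ylt ord0; rewrite /constraint_value eqxx oppr0 subr_lt0.
  by rewrite ltNge xs_min.
have [x0 [[x0_feas x0_min] x0_IPCQ]] := opt_IPCQ.
split=> // x x_feas; apply: le_trans (x0_min x x_feas).
rewrite leNgt; apply/negP => x0_lt.
(* Near x0 the objective stays below its value at [xs]; IPCQ supplies a strictly feasible y
   there. *)
have [y [y_neg y_lt]] := x0_IPCQ _ (codiff_usc (f_codiff ord0) x0_lt).
have /choice[ze zeP] i : exists ze : (R^o * H) * R, C i ze.1 /\
    ze.2 < - constraint_value f xs i /\
    forall p, dl i xs p -> dot2 dot (1, y - xs) (p + ze.1) <= ze.2.
  have : f i y - f i xs < - constraint_value f xs i.
    rewrite /constraint_value; case: eqVneq => [->|i0].
      by rewrite oppr0 subr_lt0.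
    by rewrite ltrBlDr addNr; exact: y_neg.
  move=> /(codiff_lt dot_norm (f_codiff i) (C_gen i))[z [Cz [e lt_e ez]]].
  by exists (z, e).
pose z i := (ze i).1.
pose e i := (ze i).2 + constraint_value f xs i.
(* Starting the maximum at [e ord0] rather than 0 keeps c negative. *)
pose c := \big[Num.max/e ord0]_i e i.
have e_lt0 i : e i < 0 by have [_ [+ _]] := zeP i; rewrite -ltrBrDr sub0r.
have c0 : c < 0 by apply/bigmax_ltP.
have Cz i : C i (z i) by have [] := zeP i.
have duz i : du i xs (z i) by exact: C_sub.
have Lc : forall p, Lset f dl xs z p -> dot2 dot (1, y - xs) p <= c.
  apply: (Lset_le dot_norm) => i p dp.
  have [_ [_ /(_ p dp) h]] := zeP i; apply: le_trans h _.
  by rewrite lerBrDr; exact: (le_bigmax _ e i).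
have [[a v] [avmin _]] := Lset_min_norm dot_norm f_codiff xs z.
have a0 := a_ge0 z Cz a v avmin.
have [m m_lb] := f0_bounded.
(* This bound forces f_0(x1) <= m - 1, while the minimum with c < 0 keeps x1 feasible. *)
have [x1 x1_le] := Lset_min_norm_unbounded dot_norm f_codiff duz avmin a0 c0 Lc
  (m - f ord0 xs - 1).
have [x1_lt x1_feas] := descent _ _ x1_le.
have : m <= f ord0 x1.
  apply: m_lb; exists x1 => // i i0; apply: le_trans (x1_feas i i0) _.
  by rewrite ge_min (ltW c0) orbT.
move: x1_lt; rewrite le_min => /andP[+ _]; lra.
Qed.
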